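(* For any odd prime $p$, any integer $\alpha\ge0$ and any integer $n\ge0$: (1) $b_{13}\!\left(4 p^{2\alpha+2}n+\frac{(8i+p)p^{2\alpha+1}-1}{2}\right)\equiv 0 \pmod 2$ for each $i=1,2,\ldots,p-1$; (2) $b_{13}\!\left(4 p^{2\alpha+1}n+\frac{(8j+1)p^{2\alpha}-1}{2}\right)\equiv 0 \pmod 2$ for every integer $j$ with $0\le j\le p-1$ and $\left(\frac{8j+1}{p}\right)=-1$.
   Context: For a positive integer $\ell$, $b_\ell(n)$ denotes the number of partitions of $n$ having no part divisible by $\ell$. $\left(\frac{a}{p}\right)$ is the Legendre symbol. *)

(* Defs.v *)
From mathcomp Require Import all_boot all_algebra.
Set Implicit Arguments. Unset Strict Implicit. Unset Printing Implicit Defensive.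

(* Partitions of n into parts of size at most m, as non-increasing lists of
   positive parts: [part_le f m n] enumerates them (fuel f >= n suffices). *)
Fixpoint parts_le (fuel m n : nat) {struct fuel} : seq (seq nat) :=
  match n with
  | 0 => [:: [::]]
  | _ =>
    match fuel with
    | 0 => [::]
    | f.+1 =>
      flatten [seq [seq k :: s | s <- parts_le f k (n - k)]
              | k <- iota 1 (minn m n)]
    end
  end.

Definition partitions (n : nat) : seq (seq nat) := parts_le n n n.

Definition is_partition (n : nat) (s : seq nat) : bool :=
  [&& sorted geq s, all (fun k => 0 < k) s & sumn s == n].

Definition b (l n : nat) : nat :=
  count (fun s => all (fun k => ~~ (l %| k)) s) (partitions n).

Definition legendre (a p : nat) : int :=
  if p %| a then 0%Z
  else if [exists x : 'I_p, (x * x) %% p == a %% p] then 1%Z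
  else (-1)%Z.

Goal [seq size (partitions n) | n <- iota 0 8] = [:: 1; 1; 2; 3; 5; 7; 11; 15].
Proof. by []. Qed.
Goal b 2 6 = 4. Proof. by []. Qed.

(* Main.v *)
Require Import Defs.
From mathcomp Require Import all_boot all_algebra.
From mathcomp Require Import zify ring.

(* Put f_k = prod_(n >= 1) (1 - q^(k n)); everything is modulo 2. The generating
   function of b_13 is f_13 / f_1, so f_4 * sum b_13(n) q^n = f_1^4 (f_13 / f_1)
   = f_1^3 f_13. Here f_1^3 = sum q^(s(s+1)/2) and f_13 is a pentagonal series,
   so the coefficient of q^(4m) on the right is the parity of the number of
   representations 3 x^2 + 13 y^2 = 16 (6m+1). An involution coming from complex
   conjugation in Q(sqrt(-39)) leaves only the representation x = y, so this parity
   is the coefficient of q^m in f_4. Extracting the exponents divisible by 4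
   yields f_1 * sum b_13(4m) q^m = f_4 = f_1^4, hence sum b_13(4m) q^m = f_1^3:
   b_13(4m) is odd exactly when 8m+1 is a square. In the two progressions 8m+1 has
   odd p-adic valuation, respectively is p^(2 alpha) times a nonresidue mod p. *)

Set Implicit Arguments. Unset Strict Implicit. Unset Printing Implicit Defensive.
Import GRing.Theory.

(** * Triangular and generalized pentagonal numbers *)

Definition tri (s : nat) : nat := (s * s.+1)./2.

Arguments tri : simpl never.

Lemma triE s : (tri s).*2 = (s * s.+1)%N.
Proof. by rewrite /tri even_halfK // oddM /=; case: (odd s). Qed.

Lemma triS s : tri s.+1 = (tri s + s.+1)%N.
Proof. have := triE s; have := triE s.+1; nia. Qed.

(* The positive integers prime to 6, in increasing order: 1, 5, 7, 11, ... *)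
Definition cop6 (t : nat) : nat := 3 * t + 1 + odd t.

(* Generalized pentagonal numbers 0, 1, 2, 5, 7, ... in increasing order. *)
Definition pent (t : nat) : nat := (cop6 t ^ 2 - 1) %/ 24.

Lemma pentE t : (24 * pent t + 1 = cop6 t ^ 2)%N.
Proof.
have H : (24 %| cop6 t ^ 2 - 1)%N.
  (* [cop6 t] is 6 h + 1 or 6 h + 5; its square minus 1 is 12 h (3 h + 1), respectively 12 h (3 h +
     1) + 24 (2 h + 1), and h (3 h + 1) is even. *)
  rewrite /cop6; set h := t./2.
  have [k Hk] : exists k, (h * (3 * h + 1) = 2 * k)%N.
    by exists (h * (3 * h + 1))./2; rewrite mul2n even_halfK // oddM; lia.
  have [ot|et] := boolP (odd t); apply/dvdnP.
    have -> : t = (h.*2.+1)%N by lia.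
    by exists (k + 2 * h + 1)%N; rewrite /= -muln2; nia.
  have -> : t = (h.*2)%N by lia.
  by exists k; rewrite -muln2; nia.
by rewrite /pent mulnC divnK // subnK // /cop6; nia.
Qed.

Lemma pent_odd n : (2 * pent n.*2.+1 = n.+1 * (3 * n + 2))%N.
Proof. have := pentE n.*2.+1; rewrite /cop6 /= odd_double /=; nia. Qed.

Lemma pent_even n : (2 * pent n.*2 = n * (3 * n + 1))%N.
Proof. have := pentE n.*2; rewrite /cop6 /= odd_double /=; nia. Qed.

(** * The involution on representations by 3x^2 + 13y^2 *)

(** Points moved by [f] either gain or lose rank in the enumeration of [T]; [f] exchanges the two
    classes, so together they have even size. *)
Lemma odd_card_involution (T : finType) (A : {set T}) (f : T -> T) :
  (forall x, x \in A -> f x \in A) -> (forall x, x \in A -> f (f x) = x) ->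
  odd #|A| = odd #|[set x in A | f x == x]|.
Proof.
move=> fA ffA.
pose r (x : T) : nat := enum_rank x.
have rI : injective r by move=> x y /val_inj/enum_rank_inj.
pose L := [set x in A | r x < r (f x)]; pose U := [set x in A | r (f x) < r x].
have UL : U = f @: L.
  apply/setP => x; apply/idP/imsetP => [|[y]].
    rewrite inE => /andP[xA xU]; exists (f x); last by rewrite ffA.
    by rewrite inE fA // ffA.
  by rewrite inE => /andP[yA yL] ->; rewrite inE fA // ffA.
have cU : #|U| = #|L|.
  rewrite UL card_in_imset // => x y; rewrite !inE => /andP[xA _] /andP[yA _] e.
  by rewrite -(ffA x) // e ffA.
have -> : A = [set x in A | f x == x] :|: (L :|: U).
  apply/setP => x; rewrite !inE -(inj_eq rI).
  by case: (x \in A) => //=; case: ltngtP.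
rewrite !cardsU cU (_ : L :&: U = set0); last first.
  by apply/setP => x; rewrite !inE; case: ltngtP; rewrite !(andbF, andbT).
rewrite (_ : _ :&: _ = set0); last first.
  apply/setP => x; rewrite !inE -(inj_eq rI).
  by case: ltngtP; rewrite !(andbF, andbT, andFb).
rewrite !cards0 !subn0 addnn oddD odd_double addbF; congr (odd #|pred_of_set _|).
apply/setP => x; rewrite !inE -(inj_eq rI).
by case: (x \in A) => //=; case: ltngtP.
Qed.

Local Open Scope int_scope.

(* If m = z^2 + 39 w^2 then x = 13 w - z, y = z + 3 w satisfy 3 x^2 + 13 y^2 = 16 m;
   given odd x, y > 0, exactly one sign of y makes w = (x + y) / 16 integral. The
   involution is w |-> - w. *)
Definition flip (c : nat * nat) : nat * nat :=
  let: (x, y) := c in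
  let w : int := if (16 %| x + y)%N then ((x + y) %/ 16)%N%:Z
    else if (y <= x)%N then ((x - y) %/ 16)%N%:Z else (- ((y - x) %/ 16)%N%:Z)%R in
  let y' : int := if (16 %| x + y)%N then y%:Z else (- y%:Z)%R in
  (`|(y' + 10 * w)%R|%N, `|(y' - 6 * w)%R|%N).

(** Odd coordinates are nonzero, so solutions are counted up to signs; the condition at 3 makes the
    second coordinate a value of [cop6]. *)
Definition rep39 (m : nat) (c : nat * nat) : Prop :=
  [/\ odd c.1, odd c.2, ~~ (3 %| c.2)%N & (3 * c.1 ^ 2 + 13 * c.2 ^ 2 = 16 * m)%N].

(** As [m] and [y] are odd, 3 (x^2 - y^2) = 16 (m - y^2) is divisible by 32, so 8 divides the
    product of (x - y)/2 and (x + y)/2. Their sum x is odd, so one factor is odd and 8 divides the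
    other. *)
Lemma rep39_mod16 m x y : odd m -> rep39 m (x, y) ->
  (16 %| x + y)%N \/ (exists w : int, (x%:Z - y%:Z = 16 * w)%R).
Proof.
move=> om [/= ox oy _ e].
have [a xE] : exists a, (x = 2 * a + 1)%N by exists x./2; lia.
have [c yE] : exists c, (y = 2 * c + 1)%N by exists y./2; lia.
have [k mE] : exists k, (m = 2 * k + 1)%N by exists m./2; lia.
have [z Hz] : exists z : int, ((a%:Z - c%:Z) * (a%:Z + c%:Z + 1) = 8 * z)%R.
  have [z Hz] : exists z : int, (c%:Z * (c%:Z + 1) = 2 * z)%R.
    by exists (c * c.+1)./2%:Z; have := triE c; rewrite /tri; nia.
  have e' : (3 * (a%:Z * a%:Z + a%:Z) + 13 * (c%:Z * c%:Z + c%:Z) = 8 * k%:Z)%R.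
    subst x y m; rewrite -!mulnn in e; lia.
  (* With D the product on the left, the equation gives 3 D = 8 k - 32 z; tripling it and writing 9
     D = D + 8 D yields the witness. *)
  exists (3 * k%:Z - 12 * z - (a%:Z - c%:Z) * (a%:Z + c%:Z + 1))%R.
  lia.
have [oac|eac] := boolP (odd (a + c)).
  left.
  have : (8 %| ((a%:Z - c%:Z) * (a%:Z + c%:Z + 1))%R)%Z by rewrite Hz dvdz_mulr.
  rewrite Gauss_dvdzr; last by rewrite coprimezE (@coprimeXl 3 2) // coprime2n; lia.
  lia.
right.
have : (8 %| ((a%:Z - c%:Z) * (a%:Z + c%:Z + 1))%R)%Z by rewrite Hz dvdz_mulr.
rewrite Gauss_dvdzl; last by rewrite coprimezE (@coprimeXl 3 2) // coprime2n; lia.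
case/dvdzP => w Hw; exists w; lia.
Qed.

Lemma flipP m x y : odd m -> rep39 m (x, y) -> exists y' w : int,
  [/\ (`|y'| = y)%N, (x%:Z + y' = 16 * w)%R &
      flip (x, y) = (`|(y' + 10 * w)%R|%N, `|(y' - 6 * w)%R|%N)].
Proof.
move=> om r; rewrite /flip; have [d|nd] := boolP (16 %| x + y)%N.
  exists y%:Z, ((x + y) %/ 16)%N%:Z; split => //; lia.
have [/idPn //|[w Hw]] := rep39_mod16 om r.
exists (- y%:Z)%R, w; split; [lia|lia|].
suff -> : (if (y <= x)%N then ((x - y) %/ 16)%N%:Z else (- ((y - x) %/ 16)%N%:Z)%R) = w by [].
case: (leqP y x) => xy.
  have -> : (x - y = `|w| * 16)%N by lia.
  rewrite mulnK //; lia.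
have -> : (y - x = `|w| * 16)%N by lia.
rewrite mulnK //; lia.
Qed.

Lemma flip_rep39 m c : odd m -> rep39 m c -> rep39 m (flip c).
Proof.
case: c => x y om r; have [y' [w [Hy Hw ->]]] := flipP om r.
case: r => /= ox oy y3 e; split => /=; [lia|lia|lia|].
have sq (v : int) : ((`|v| ^ 2)%N = v * v :> int)%R by rewrite -mulnn; nia.
have e' : (3 * (x%:Z * x%:Z) + 13 * (y' * y') = 16 * m%:Z)%R.
  by rewrite -(sq y') Hy; rewrite -!mulnn in e *; lia.
have {}Hw : (x%:Z = 16 * w - y')%R by lia.
rewrite Hw in e'.
by have := sq (y' + 10 * w)%R; have := sq (y' - 6 * w)%R; lia.
Qed.

(** Since y is odd, 16 divides only one of x + y and x - y, so the second application meets the same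
    w up to sign. *)
Lemma flipK m c : odd m -> rep39 m c -> flip (flip c) = c.
Proof.
case: c => x y om r; have r' := flip_rep39 om r; move: r'.
have [y' [w [Hy Hw ->]]] := flipP om r => r'.
have [y'' [w' [Hy' Hw' ->]]] := flipP om r'.
case: r => /= ox oy y3 e; congr pair; lia.
Qed.

(** Preserving the second coordinate means w = 0 or y' = 3 w. The latter is excluded because 3 does
    not divide y, and w = 0 means x = - y', that is x = y. *)
Lemma flip_fix m x y : odd m -> rep39 m (x, y) -> flip (x, y) = (x, y) <-> x = y.
Proof.
move=> om r; have [y' [w [Hy Hw ->]]] := flipP om r.
case: r => /= ox oy y3 e; split => [[]|xy].
  lia.
by congr pair; lia.
Qed.

Local Close Scope int_scope.

Lemma cop6_div3 t : cop6 t %/ 3 = t.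
Proof. by rewrite /cop6; case: (odd t) => /=; lia. Qed.

Lemma div3_cop6 y : odd y -> ~~ (3 %| y) -> cop6 (y %/ 3) = y.
Proof.
move=> oy y3; rewrite /cop6.
have [o|e] := boolP (odd (y %/ 3)) => /=; lia.
Qed.

Lemma odd_cop6 t : odd (cop6 t).
Proof. by rewrite /cop6; case: (boolP (odd t)) => /=; lia. Qed.

Lemma cop6_mod3 t : ~~ (3 %| cop6 t).
Proof. by rewrite /cop6; case: (boolP (odd t)) => /=; lia. Qed.

(** Multiply by 24 and complete the squares: 8 tri s + 1 = (2 s + 1)^2 and 24 pent t + 1 = (cop6
    t)^2. *)
Lemma rep39E m s t :
  rep39 (6 * m + 1) (2 * s + 1, cop6 t) <-> tri s + 13 * pent t = 4 * m.
Proof.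
have ts := triE s; have pt := pentE t; split => [[/= _ _ _ e]|e].
  by rewrite -!mulnn in e pt; nia.
split => /=; [lia| | |].
- exact: odd_cop6.
- exact: cop6_mod3.
by rewrite -!mulnn in pt *; nia.
Qed.

(** [flip] is transported to the index pairs; a fixed point x = y = cop6 t satisfies 24 pent t + 1 =
    6 m + 1. The bound on [K] keeps every solution in range of [inord]. *)
Lemma odd_card_rep39 m K : 16 * (6 * m + 1) <= K ->
  odd #|[set c : 'I_K.+1 * 'I_K.+1 | tri c.1 + 13 * pent c.2 == 4 * m]| =
  odd #|[set t : 'I_K.+1 | 4 * pent t == m]|.
Proof.
move=> mK; set S := [set c | _]; set T := [set t | _].
pose e (c : 'I_K.+1 * 'I_K.+1) := (2 * c.1 + 1, cop6 c.2).
pose d (c : nat * nat) : 'I_K.+1 * 'I_K.+1 := (inord c.1./2, inord (c.2 %/ 3)).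
have om : odd (6 * m + 1) by lia.
have eS c : c \in S -> rep39 (6 * m + 1) (e c).
  by rewrite inE => /eqP /rep39E.
have ed c : rep39 (6 * m + 1) c -> e (d c) = c.
  case: c => x y [/= ox oy y3 E].
  have xx : x <= x ^ 2 by rewrite -mulnn leq_pmulr // odd_gt0.
  have yy : y <= y ^ 2 by rewrite -mulnn leq_pmulr // odd_gt0.
  move: (x ^ 2) (y ^ 2) xx yy E => x2 y2 xx yy E.
  rewrite /e /d /= !inordK; [|lia|lia].
  by rewrite div3_cop6 //; congr pair; lia.
have de c : d (e c) = c.
  case: c => s t; rewrite /e /d /= cop6_div3 (_ : (2 * s + 1)./2 = s); last by lia.
  by rewrite !inord_val.
have dS c : rep39 (6 * m + 1) c -> d c \in S.
  by move=> r; rewrite inE; apply/eqP/rep39E; rewrite -/(e (d c)) ed.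
rewrite (@odd_card_involution _ S (fun c => d (flip (e c)))); first last.
- by move=> c cS; rewrite ed ?(flipK om) ?de //;
    [exact: eS|apply: flip_rep39 => //; exact: eS].
- by move=> c cS; apply: dS; apply: flip_rep39 => //; exact: eS.
(* Injectivity is read off the second coordinate: for large [t] the first may leave the range and
   fall to the default of [inord]. *)
congr (odd _); rewrite -(@card_imset _ _ (fun t : 'I_K.+1 => d (cop6 t, cop6 t))); last first.
  by move=> t t' [_ /(congr1 val)]; rewrite /= !cop6_div3 !inord_val => /val_inj.
apply: eq_card => c; apply/idP/imsetP.
  rewrite inE => /andP[cS /eqP fc].
  have xy : (e c).1 = (e c).2.
    apply/(flip_fix om); rewrite -surjective_pairing; first exact: eS.
    by rewrite -{2}fc ed //; apply: flip_rep39 => //; exact: eS.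
  exists c.2; last by rewrite -[LHS]de {1}[e c]surjective_pairing xy.
  have [_ _ _] := eS c cS; rewrite xy /e inE /= -pentE => E.
  by apply/eqP; lia.
case=> t; rewrite [t \in T]inE => /eqP tm ->.
have r : rep39 (6 * m + 1) (cop6 t, cop6 t).
  split => /=; [exact: odd_cop6|exact: odd_cop6|exact: cop6_mod3|].
  by rewrite -pentE; lia.
rewrite inE dS // ed //.
by rewrite (flip_fix om r).2 // eqxx.
Qed.

(** * Finite forms of the theta series *)

Local Open Scope ring_scope.

(** The exponents run from a + 1 to b, so this is the quotient of the q-factorials (q; q)_b and (q;
    q)_a. *)
Definition euler_prod (R : comNzRingType) (q : R) (a b : nat) : R :=
  \prod_(a <= k < b) (1 - q ^+ k.+1).

Lemma euler_prod_nil (R : comNzRingType) (q : R) a : euler_prod q a a = 1.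
Proof. by rewrite /euler_prod big_geq. Qed.

Lemma euler_prod_recr (R : comNzRingType) (q : R) a b : (a <= b)%N ->
  euler_prod q a b.+1 = euler_prod q a b * (1 - q ^+ b.+1).
Proof. by move=> ab; rewrite /euler_prod big_nat_recr. Qed.

Lemma euler_prod_recl (R : comNzRingType) (q : R) a b : (a < b)%N ->
  euler_prod q a b = (1 - q ^+ a.+1) * euler_prod q a.+1 b.
Proof. by move=> ab; rewrite /euler_prod big_ltn. Qed.

(* Shanks (1951): the summand s = 0 is prod_(k <= n) (1 - q^k), the others are O(q^(n+1)),
   while the whole sum is a partial sum of the pentagonal series. *)
Definition shanks_pent (R : comNzRingType) (q : R) n s : R :=
  (-1) ^+ s * euler_prod q s n * q ^+ (s * n + tri s).

(** Stopping the sum at any [m] leaves a single boundary term in closed form, which makes the step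
    from n to n + 1 provable by induction on [m]. *)
Lemma shanks_pent_partial (R : comNzRingType) (q : R) n m : (m <= n)%N ->
  \sum_(0 <= s < m.+1) shanks_pent q n.+1 s =
  \sum_(0 <= s < m.+1) shanks_pent q n s
  + (-1) ^+ m.+1 * euler_prod q m n * q ^+ (m.+1 * n + tri m.+1).
Proof.
elim: m => [|m IH] mn.
  rewrite !big_nat1 /shanks_pent euler_prod_recr // -[tri 0]/0%N -[tri 1]/1%N.
  by rewrite !mul0n mul1n expr0 expr1 addn1; ring.
rewrite big_nat_recr //= IH ?(ltnW mn) // [in RHS]big_nat_recr //= -!addrA; congr +%R.
rewrite /shanks_pent euler_prod_recr // [euler_prod q m n]euler_prod_recl //.
rewrite (_ : m.+2 * n + tri m.+2 = (m.+1 * n + tri m.+1) + n + m.+2)%N; last first.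
  by rewrite triS; nia.
rewrite (_ : m.+1 * n.+1 + tri m.+1 = (m.+1 * n + tri m.+1) + m.+1)%N; last by nia.
move: (m.+1 * n + tri m.+1)%N => e.
by rewrite !(exprS, exprD); ring.
Qed.

(** Each step adds the boundary term at m = n and the new summand s = n + 1; their exponents are the
    next two pentagonal numbers. *)
Lemma sum_shanks_pent (R : comNzRingType) (q : R) n :
  \sum_(0 <= s < n.+1) shanks_pent q n s =
  \sum_(0 <= t < n.*2.+1) (-1) ^+ (uphalf t) * q ^+ pent t.
Proof.
elim: n => [|n IH].
  by rewrite !big_nat1 /shanks_pent euler_prod_nil mulr1.
rewrite big_nat_recr //= shanks_pent_partial // IH doubleS.
rewrite [in RHS]big_nat_recr //= [in X in _ = X + _]big_nat_recr //= -!addrA.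
congr +%R; rewrite /shanks_pent !euler_prod_nil uphalf_double mulr1.
congr (_ * q ^+ _ + _ * q ^+ _).
- by rewrite half_double.
- by have := pent_odd n; have := triE n.+1; rewrite -!muln2; nia.
- by have := pent_even n.+1; have := triE n.+1; rewrite doubleS -!muln2; nia.
Qed.

Definition odd_prod (R : comNzRingType) (q : R) n : R :=
  \prod_(0 <= k < n) (1 - q ^+ k.*2.+1).

(** The analogue for Gauss's triangular series: the summand s = 0 is prod_(k <= n) (1 - q^(2k)), the
    others are O(q^(2n+1)). *)
Definition shanks_tri (R : comNzRingType) (q : R) n s : R :=
  euler_prod (q ^+ 2) s n * odd_prod q s * q ^+ (s * n.*2.+1).

Lemma shanks_tri_partial (R : comNzRingType) (q : R) n m : (m <= n)%N ->
  \sum_(0 <= s < m.+1) shanks_tri q n.+1 s =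
  (1 - q ^+ n.*2.+1) * (\sum_(0 <= s < m.+1) shanks_tri q n s)
  + euler_prod (q ^+ 2) m n * odd_prod q m.+1 * q ^+ (m.+1 * n.*2.+1).
Proof.
elim: m => [|m IH] mn.
  rewrite !big_nat1 /shanks_tri euler_prod_recr // /odd_prod big_nat1 big_geq //= !mul0n.
  rewrite mul1n -muln2 -exprM (_ : 2 * n.+1 = n * 2 + 2)%N; last by lia.
  by rewrite !(exprS, exprD); ring.
rewrite big_nat_recr //= IH ?(ltnW mn) // [in RHS]big_nat_recr //= mulrDr -!addrA; congr +%R.
rewrite /shanks_tri euler_prod_recr // [euler_prod _ m n]euler_prod_recl //.
rewrite (_ : odd_prod q m.+2 = odd_prod q m.+1 * (1 - q ^+ m.+1.*2.+1)); last first.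
  by rewrite /odd_prod big_nat_recr.
rewrite (_ : m.+2 * n.*2.+1 = (m.+1 * n.*2.+1) + n.*2.+1)%N; last by nia.
rewrite (_ : m.+1 * n.+1.*2.+1 = (m.+1 * n.*2.+1) + m.+1.*2)%N; last by nia.
move: (m.+1 * n.*2.+1)%N => e; rewrite -!muln2 -!exprM.
rewrite (_ : 2 * n.+1 = n * 2 + 2)%N; last by lia.
rewrite (_ : 2 * m.+1 = m * 2 + 2)%N; last by lia.
rewrite (_ : m.+1 * 2 = m * 2 + 2)%N; last by lia.
by rewrite !(exprS, exprD); ring.
Qed.

Lemma sum_shanks_tri (R : comNzRingType) (q : R) n :
  \sum_(0 <= s < n.+1) shanks_tri q n s =
  odd_prod q n * \sum_(0 <= t < n.*2.+1) q ^+ tri t.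
Proof.
elim: n => [|n IH].
  by rewrite !big_nat1 /shanks_tri euler_prod_nil /odd_prod big_geq //= !mulr1.
rewrite big_nat_recr //= shanks_tri_partial // IH doubleS.
rewrite [in RHS]big_nat_recr //= [\sum_(0 <= t < n.*2.+2) _]big_nat_recr //=.
rewrite /shanks_tri !euler_prod_nil.
rewrite (_ : odd_prod q n.+1 = odd_prod q n * (1 - q ^+ n.*2.+1)); last first.
  by rewrite /odd_prod big_nat_recr.
rewrite (_ : tri n.*2.+1 = n.+1 * n.*2.+1)%N; last by have := triE n.*2.+1; nia.
rewrite (_ : tri n.*2.+2 = n.+1 * n.*2.+3)%N; last by have := triE n.*2.+2; nia.
by rewrite doubleS -!addrA !mul1r mulrA [X in X * \sum_(_ <= _ < _) _]mulrC !mulrDr.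
Qed.

(** * Power series modulo X^N *)

Definition eqmodX (R : nzRingType) (N : nat) (p r : {poly R}) : Prop :=
  forall i, (i < N)%N -> p`_i = r`_i.

Notation "p = r %[modX N ]" := (eqmodX N p r)
  (at level 70, r at next level, format "p  =  r  %[modX  N ]") : type_scope.

Lemma eqmodX_sym (R : nzRingType) N (p r : {poly R}) :
  p = r %[modX N] -> r = p %[modX N].
Proof. by move=> pr i iN; rewrite pr. Qed.

Lemma eqmodX_trans (R : nzRingType) N (p r s : {poly R}) :
  p = r %[modX N] -> r = s %[modX N] -> p = s %[modX N].
Proof. by move=> pr rs i iN; rewrite pr // rs. Qed.

Lemma eqmodXW (R : nzRingType) N M (p r : {poly R}) : (M <= N)%N ->
  p = r %[modX N] -> p = r %[modX M].
Proof. by move=> MN pr i iM; rewrite pr // (leq_trans iM). Qed.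

Lemma eqmodXM (R : nzRingType) N (p p' r r' : {poly R}) :
  p = p' %[modX N] -> r = r' %[modX N] -> p * r = p' * r' %[modX N].
Proof.
move=> pp rr i iN; rewrite !coefM; apply: eq_bigr => j _.
by rewrite pp ?rr //; have := ltn_ord j; lia.
Qed.

Lemma eqmodX_prod1 (R : nzRingType) N (I : Type) (s : seq I) (P : pred I) (F : I -> {poly R}) :
  (forall i, P i -> F i = 1 %[modX N]) -> \prod_(i <- s | P i) F i = 1 %[modX N].
Proof.
move=> F1; elim/big_ind: _ => // x y x1 y1.
by have := eqmodXM x1 y1; rewrite mulr1.
Qed.

(** Strong induction on the index: the constant term 1 isolates the i-th coefficient, and the rest
    of the convolution involves only smaller indices. *)
Lemma eqmodX_cancel (R : comNzRingType) N (u p r : {poly R}) : u`_0 = 1 ->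
  u * p = u * r %[modX N] -> p = r %[modX N].
Proof.
move=> u0 upr i; elim/ltn_ind: i => i IH iN.
have := upr i iN; rewrite !coefM !big_ord_recl /= u0 !mul1r !subn0.
rewrite (eq_bigr (fun j : 'I_i => u`_(lift ord0 j) * r`_(i - lift ord0 j))) => [/addIr //|j _].
by rewrite IH // /lift /= /bump; have := ltn_ord j; lia.
Qed.

Lemma eqmodX_comp_Xn (R : nzRingType) N k (p r : {poly R}) : (0 < k)%N ->
  p = r %[modX N] -> p \Po 'X^k = r \Po 'X^k %[modX N].
Proof.
move=> k0 pr i iN; rewrite !coef_comp_poly_Xn //; case: ifP => // _.
by rewrite pr // (leq_ltn_trans (leq_div _ _)).
Qed.

Lemma euler_prod_trunc (R : comNzRingType) a b :
  euler_prod ('X : {poly R}) a b = 1 %[modX a.+1].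
Proof.
rewrite /euler_prod big_nat; apply: eqmodX_prod1 => k /andP[ak _] i ia.
by rewrite coefB coefXn coef1 [i == k.+1]ltn_eqF ?subr0 // (leq_trans ia).
Qed.

Lemma euler_prod_widen (R : comNzRingType) a b : (a <= b)%N ->
  euler_prod ('X : {poly R}) 0 b = euler_prod 'X 0 a %[modX a.+1].
Proof.
move=> ab; rewrite {1}/euler_prod (big_cat_nat _ ab) //=.
rewrite -[X in _ = X %[modX _]]mulr1; apply: eqmodXM => //.
exact: euler_prod_trunc.
Qed.

Lemma euler_prod_coef0 (R : comNzRingType) b : (euler_prod ('X : {poly R}) 0 b)`_0 = 1.
Proof. by rewrite euler_prod_trunc // coef1. Qed.

Lemma euler_prod_comp (R : comNzRingType) l a b :
  euler_prod ('X : {poly R}) a b \Po 'X^l = euler_prod 'X^l a b.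
Proof.
rewrite /euler_prod rmorph_prod; apply: eq_bigr => k _.
by rewrite /= comp_polyB comp_polyC comp_Xn_poly.
Qed.

(** * Frobenius over F_2 and the series for f_1 and f_1^3 *)

Lemma sqr_polyF2 (p : {poly 'F_2}) : p ^+ 2 = p \Po 'X^2.
Proof.
elim/poly_ind: p => [|p c IH]; first by rewrite expr0n comp_poly0.
rewrite sqrrD exprMn IH comp_poly_MXaddC -mulr_natr -polyC_natr.
rewrite (_ : 2%:R = 0 :> 'F_2); last by apply/val_inj.
rewrite mulr0 addr0; congr (_ + _).
rewrite -polyC_exp; congr polyC.
by case: c => [[|[|]]] //= i; apply/val_inj.
Qed.

Lemma exp4_polyF2 (p : {poly 'F_2}) : p ^+ 4 = p \Po 'X^4.
Proof.
by rewrite (_ : 4 = 2 * 2)%N // exprM (sqr_polyF2 p) (sqr_polyF2 (_ \Po _))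
  -comp_polyA comp_Xn_poly -exprM.
Qed.

Lemma opp_polyF2 (p : {poly 'F_2}) : - p = p.
Proof.
by apply/polyP => i; rewrite coefN; case: (p`_i) => [[|[|]]] //= h; apply/val_inj.
Qed.

Lemma euler_pent N : euler_prod ('X : {poly 'F_2}) 0 N =
  \sum_(0 <= t < N.*2.+1) 'X^(pent t) %[modX N.+1].
Proof.
have := sum_shanks_pent ('X : {poly 'F_2}) N.
rewrite opp_polyF2; under [RHS]eq_bigr do rewrite expr1n mul1r.
move=> <- i iN; rewrite big_ltn // coefD coef_sum [X in _ + X]big_nat big1 => [|s /andP[s1 _]].
  by rewrite addr0 /shanks_pent expr0 mul1r mulr1.
by rewrite /shanks_pent coefMXn ifT //; have := triE s; nia.
Qed.

Lemma odd_prod_even_prod (R : comNzRingType) (q : R) n :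
  odd_prod q n * euler_prod (q ^+ 2) 0 n = euler_prod q 0 n.*2.
Proof.
elim: n => [|n IH]; first by rewrite /odd_prod /euler_prod !big_geq // mulr1.
rewrite doubleS !euler_prod_recr // -IH /odd_prod big_nat_recr //= -exprM mul2n doubleS.
by ring.
Qed.

(** Gauss's identity gives f_2 = [odd_prod] * psi, and f_2 = P^2 over F_2. Multiplying by P^2 = f_2
    and using [odd_prod] * f_2 = P gives P^4 = P psi, and P cancels. *)
Lemma euler_cube N : euler_prod ('X : {poly 'F_2}) 0 N ^+ 3 =
  \sum_(0 <= t < N.*2.+1) 'X^(tri t) %[modX N.+1].
Proof.
set P := euler_prod _ _ _; set psi := \sum_(_ <= _ < _) _.
have H : P ^+ 2 = odd_prod 'X N * psi %[modX N.+1].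
  rewrite -sum_shanks_tri => i iN.
  rewrite big_ltn // coefD coef_sum [X in _ + X]big_nat big1 => [|s /andP[s1 _]].
    by rewrite addr0 /shanks_tri /odd_prod [\prod_(_ <= _ < _) _]big_geq // !mulr1
      sqr_polyF2 euler_prod_comp.
  by rewrite /shanks_tri coefMXn ifT //; nia.
apply: (@eqmodX_cancel _ _ P); first exact: euler_prod_coef0.
rewrite -exprS (_ : 4 = 2 + 2)%N // exprD.
apply: eqmodX_trans (_ : P ^+ 2 * (odd_prod 'X N * psi) = _ %[modX _]).
  exact: eqmodXM.
rewrite mulrA [P ^+ 2 * _]mulrC {1}sqr_polyF2 euler_prod_comp odd_prod_even_prod.
by apply: eqmodXM => //; apply: euler_prod_widen; lia.
Qed.

(** * The generating function of b_l *)

Definition b_le (l m n : nat) : nat :=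
  count (fun s => all (fun k => ~~ (l %| k)%N) s) (parts_le n m n).

Lemma count_parts_leS l f m n :
  count (fun s => all (fun k => ~~ (l %| k)%N) s) (parts_le f.+1 m n.+1) =
  (\sum_(1 <= k < (minn m n.+1).+1 | ~~ (l %| k)%N)
    count (fun s => all (fun k => ~~ (l %| k)%N) s) (parts_le f k (n.+1 - k)))%N.
Proof.
rewrite [parts_le _ _ _]/= count_flatten -map_comp sumnE big_map.
rewrite /index_iota subSS subn0 [RHS]big_mkcond; apply: eq_bigr => k _ /=.
rewrite count_map; case: (boolP (l %| k)%N) => lk /=.
  by rewrite -(count_pred0 (parts_le f k (n.+1 - k))); apply: eq_count => s; rewrite /= lk.
by apply: eq_count => s; rewrite /= lk.
Qed.

(** Recursive calls of [parts_le] carry more fuel than the remaining sum, so the count must be freed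
    from the fuel before a recurrence can be stated. *)
Lemma count_parts_le_fuel l f m n : (n <= f)%N ->
  count (fun s => all (fun k => ~~ (l %| k)%N) s) (parts_le f m n) = b_le l m n.
Proof.
elim/ltn_ind: n f m => -[|n] IH [|f] m // nf.
rewrite /b_le (count_parts_leS l f) (count_parts_leS l n) [LHS]big_nat_cond
  [RHS]big_nat_cond; apply: eq_bigr => k /andP[/andP[k1 km] lk].
by rewrite (IH (n.+1 - k)%N) ?(IH (n.+1 - k)%N) //; lia.
Qed.

Lemma b_leS l m n : b_le l m n.+1 =
  (\sum_(1 <= k < (minn m n.+1).+1 | ~~ (l %| k)) b_le l k (n.+1 - k))%N.
Proof.
rewrite {1}/b_le count_parts_leS [LHS]big_nat_cond
  [RHS]big_nat_cond; apply: eq_bigr => k /andP[/andP[k1 km] lk].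
by rewrite count_parts_le_fuel //; lia.
Qed.

(** Either m + 1 is not a part, or one copy of it, necessarily the largest part, is removed. *)
Lemma b_le_recr l m n : b_le l m.+1 n =
  (b_le l m n + (if (m < n)%N && ~~ (l %| m.+1)%N then b_le l m.+1 (n - m.+1) else 0))%N.
Proof.
case: n => [|n] //; rewrite !b_leS; have [mn|mn] := ltnP m n.+1.
  rewrite (minn_idPl mn) ?(minn_idPl (ltnW mn)) big_mkcond big_nat_recr //=.
  by rewrite -big_mkcond.
by rewrite (minn_idPr (leqW mn)) ?(minn_idPr mn) addn0.
Qed.

Lemma b_le_large l m n : (n <= m)%N -> b_le l m n = b l n.
Proof.
rewrite /b /partitions -/(b_le l n n); case: n => [|n] // nm.
by rewrite !b_leS minnn (minn_idPr nm).
Qed.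

Lemma b_le0 l n : b_le l 0 n = (n == 0)%N.
Proof. by case: n => // n; rewrite b_leS min0n big_geq. Qed.

Lemma b_le_gen (R : comNzRingType) l m N :
  (\poly_(n < N) (b_le l m n)%:R) * \prod_(0 <= k < m | ~~ (l %| k.+1)%N) (1 - 'X^(k.+1))
  = (1 : {poly R}) %[modX N].
Proof.
elim: m => [|m IH].
  by rewrite big_geq // mulr1 => i iN; rewrite coef_poly iN b_le0 coef1.
apply: eqmodX_trans IH; rewrite big_mkcond big_nat_recr //= -big_mkcond.
rewrite [X in _ * X]mulrC mulrA; apply: eqmodXM => // i iN.
case: (boolP (l %| m.+1)%N) => lm /=.
  by rewrite mulr1 !coef_poly iN b_le_recr lm andbF addn0.
rewrite mulrBr mulr1 coefB coefMXn !coef_poly iN b_le_recr lm andbT ltnS.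
case: (ltnP m i) => mi; rewrite ?addn0 ?subr0 //.
rewrite ifT ?natrD ?addrK //; lia.
Qed.

Lemma euler_prod_multiples (R : comNzRingType) (q : R) l N : (0 < l)%N ->
  \prod_(0 <= k < l * N | (l %| k.+1)%N) (1 - q ^+ k.+1) = euler_prod (q ^+ l) 0 N.
Proof.
case: l => // l _; elim: N => [|N IH]; first by rewrite muln0 /euler_prod !big_geq.
rewrite euler_prod_recr // -IH (@big_cat_nat _ _ _ (l.+1 * N)) //=; last by nia.
congr (_ * _); rewrite mulnS addnC addnS big_mkcond big_nat_recr ?leq_addr //=.
(* In a block of l + 1 consecutive exponents only the last is a multiple of l + 1. *)
rewrite big_nat big1 => [|k /andP[k1 k2]]; last first.
  case: ifP => // /dvdnP[x xk]; exfalso.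
  have xN : (N < x)%N by rewrite -(ltn_pmul2r (ltn0Sn l)) -xk mulnC; lia.
  have : (x < N.+1)%N by rewrite -(ltn_pmul2r (ltn0Sn l)) -xk mulnC mulnS; lia.
  lia.
rewrite mul1r -exprM (_ : (l.+1 * N + l).+1 = l.+1 * N.+1)%N; last by rewrite mulnS addnC.
by rewrite dvdn_mulr.
Qed.

Lemma b_gen (R : comNzRingType) l N : (0 < l)%N ->
  euler_prod 'X 0 N * \poly_(n < N.+1) (b l n)%:R
  = euler_prod ('X : {poly R}) 0 N \Po 'X^l %[modX N.+1].
Proof.
move=> l0.
(* With length l N, the factors whose exponent is divisible by l form exactly f_l of length N; the
   remaining factors cancel the series by [b_le_gen]. *)
apply: eqmodX_trans
  (_ : euler_prod 'X 0 (l * N) * \poly_(n < N.+1) (b_le l (l * N) n)%:R = _ %[modX _]).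
  apply: eqmodXM; first by apply/eqmodX_sym/euler_prod_widen; nia.
  by move=> i iN; rewrite !coef_poly iN b_le_large //; nia.
rewrite euler_prod_comp -euler_prod_multiples // {1}/euler_prod.
rewrite (bigID (fun k => (l %| k.+1)%N)) /=.
rewrite -mulrA [X in _ * X]mulrC -[X in _ = X %[modX _]]mulr1.
by apply: eqmodXM => //; apply: b_le_gen.
Qed.

(** * Parities as coefficients, and extraction of the exponents divisible by 4 *)

Lemma natrF2 n : n%:R = (odd n)%:R :> 'F_2.
Proof. by apply/val_inj; rewrite /= !val_Fp_nat // !modn2; case: (odd n). Qed.

Lemma coef_sum_Xn (R : nzRingType) K (e : nat -> nat) i :
  (\sum_(0 <= t < K) 'X^(e t) : {poly R})`_i = #|[set t : 'I_K | e t == i]|%:R.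
Proof.
rewrite coef_sum big_mkord -sum1_card natr_sum [RHS]big_mkcond.
by apply: eq_bigr => t _; rewrite coefXn inE eq_sym; case: eqP.
Qed.

Lemma coef_sum_XnM (R : nzRingType) K L (e f : nat -> nat) i :
  ((\sum_(0 <= s < K) 'X^(e s)) * (\sum_(0 <= t < L) 'X^(f t)) : {poly R})`_i =
  #|[set c : 'I_K * 'I_L | e c.1 + f c.2 == i]%N|%:R.
Proof.
rewrite !big_mkord big_distrlr pair_big coef_sum -sum1_card natr_sum [RHS]big_mkcond.
by apply: eq_bigr => c _; rewrite /= -exprD coefXn inE eq_sym; case: eqP.
Qed.

Lemma sum_Xn_comp (R : comNzRingType) K (e : nat -> nat) l :
  (\sum_(0 <= t < K) 'X^(e t)) \Po 'X^l = \sum_(0 <= t < K) 'X^(l * e t) :> {poly R}.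
Proof.
rewrite rmorph_sum; apply: eq_bigr => t _.
by rewrite /= comp_Xn_poly exprM.
Qed.

Lemma coef_comp_XnM (R : comNzRingType) l (p r : {poly R}) i : (0 < l)%N ->
  ((p \Po 'X^l) * r)`_(l * i) = \sum_(j < i.+1) p`_j * r`_(l * (i - j)).
Proof.
move=> l0; rewrite coefM.
have H (j : nat) : (j < i.+1)%N -> (l * j < (l * i).+1)%N by rewrite !ltnS leq_pmul2l.
rewrite (bigID (fun j : 'I_(l * i).+1 => (l %| j)%N)) /= [X in _ + X]big1 ?addr0; last first.
  by move=> j nj; rewrite coef_comp_poly_Xn // (negbTE nj) mul0r.
rewrite (reindex (fun j : 'I_i.+1 => inord (l * j)%N : 'I_(l * i).+1)) /=; last first.
  exists (fun j => inord (j %/ l)) => j jl.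
    by rewrite (inordK (H _ (ltn_ord j))) mulKn // inord_val.
  have ji : (j %/ l < i.+1)%N by rewrite ltnS leq_divLR // (mulnC i) -ltnS.
  by rewrite (inordK ji) (mulnC l (j %/ l)%N) divnK ?inord_val.
apply: eq_big => [j|j _]; first by rewrite inordK ?H // dvdn_mulr.
by rewrite inordK ?H // coef_comp_poly_Xn // dvdn_mulr // mulKn // mulnBr.
Qed.

Lemma odd_b13 m : odd (b 13 (4 * m)) -> exists s, tri s = m.
Proof.
(* Large enough for 16 (6 i + 1) <= 2 N and 4 i <= N whenever i <= m. *)
move=> ob; pose N := (96 * m + 100)%N.
pose P := euler_prod ('X : {poly 'F_2}) 0 N.
pose B : {poly 'F_2} := \poly_(n < N.+1) (b 13 n)%:R.
pose D : {poly 'F_2} := \poly_(n < m.+1) (b 13 (4 * n))%:R.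
pose psi : {poly 'F_2} := \sum_(0 <= t < N.*2.+1) 'X^(tri t).
pose theta : {poly 'F_2} := \sum_(0 <= t < N.*2.+1) 'X^(pent t).
have P0 : P`_0 = 1 by exact: euler_prod_coef0.
have P4B : P ^+ 4 * B = psi * (theta \Po 'X^13) %[modX N.+1].
  rewrite exprSr -mulrA; apply: eqmodXM; first exact: euler_cube.
  apply: eqmodX_trans; first exact: b_gen.
  by apply: eqmodX_comp_Xn => //; apply: euler_pent.
have PD : P * D = P * P ^+ 3 %[modX m.+1].
  move=> i im; rewrite -exprS.
  have iN : (4 * i < N.+1)%N by rewrite /N; lia.
  (* Since P^4 = P(X^4), the coefficient at 4 i of P^4 B only sees the values b_13(4 n), and equals
     that of P D at i. *)
  transitivity ((P ^+ 4 * B)`_(4 * i)).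
    rewrite exp4_polyF2 coef_comp_XnM // coefM; apply: eq_bigr => j _.
    by rewrite !coef_poly !ifT //; lia.
  rewrite P4B // sum_Xn_comp coef_sum_XnM natrF2 odd_card_rep39; last by rewrite /N; lia.
  rewrite -natrF2 exp4_polyF2 -(@coef_sum_Xn _ _ (fun t => 4 * pent t)%N) -sum_Xn_comp.
  symmetry.
  by apply: (@eqmodX_comp_Xn _ N.+1) => //; [exact: euler_pent|rewrite /N; lia].
have Dpsi : D = psi %[modX m.+1].
  apply: eqmodX_trans (eqmodX_cancel P0 PD) _.
  by apply: (@eqmodXW _ N.+1); [rewrite /N; lia|exact: euler_cube].
have := Dpsi m (ltnSn m); rewrite coef_poly ltnSn natrF2 ob coef_sum_Xn.
case: (set_0Vmem [set t : 'I_N.*2.+1 | tri t == m]) => [->|[s]].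
  by rewrite cards0 => /eqP; rewrite oner_eq0.
by rewrite inE => /eqP sm _; exists s.
Qed.

Local Close Scope ring_scope.

(** * Nonsquares in the two progressions *)

Lemma odd_b13_square n x : 2 * n + 1 = x -> x %% 8 = 1 ->
  odd (b 13 n) -> exists s, s ^ 2 = x.
Proof.
move=> nx x8; have -> : n = 4 * (n %/ 4) by lia.
case/odd_b13 => s sn; exists (2 * s + 1).
by have := triE s; rewrite -mulnn; nia.
Qed.

Lemma sqr_odd_mod8 p k : odd p -> p ^ (2 * k) %% 8 = 1.
Proof.
move=> op; rewrite expnM -modnXm (_ : p ^ 2 %% 8 = 1) ?exp1n //.
rewrite -modnXm; have : odd (p %% 8) by lia.
by have := ltn_pmod p (isT : 0 < 8); case: (p %% 8) => [|[|[|[|[|[|[|[|]]]]]]]].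
Qed.

Theorem theorem3p14 (p alpha n : nat) :
  prime p -> odd p ->
  (forall i : nat, 1 <= i <= p - 1 ->
     odd (b 13 (4 * p ^ (2 * alpha + 2) * n
                + ((8 * i + p) * p ^ (2 * alpha + 1) - 1) %/ 2)) = false) /\
  (forall j : nat, j <= p - 1 -> legendre (8 * j + 1) p = (-1)%Z ->
     odd (b 13 (4 * p ^ (2 * alpha + 1) * n
                + ((8 * j + 1) * p ^ (2 * alpha) - 1) %/ 2)) = false).
Proof.
move=> pp op; have p0 := prime_gt0 pp; split=> [i /andP[i0 ip]|j jp leg];
  apply/negbTE/negP => ob.
- have q8 := sqr_odd_mod8 (alpha + 1) op.
  (* Twice the argument of b_13 plus 1 is p^(2 alpha + 1) u, with u prime to p. *)
  pose u := 8 * (p * n + i) + p.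
  have pu : ~~ (p %| u).
    rewrite dvdn_addl // Gauss_dvdr ?(coprimeXr 3 (n := 2)) ?coprimen2 //.
    by rewrite dvdn_addr ?dvdn_mulr // gtnNdvd //; lia.
  have [s su] : exists s, s ^ 2 = p ^ (2 * alpha + 1) * u.
    apply: odd_b13_square ob.
      have : odd ((8 * i + p) * p ^ (2 * alpha + 1)) by rewrite oddM oddX op; lia.
      rewrite /u (_ : 2 * alpha + 2 = (2 * alpha + 1).+1) ?expnS; last by lia.
      by move: (p ^ _) => q oq; nia.
    rewrite -modnMmr (_ : u %% 8 = p %% 8); last by rewrite /u; lia.
    by rewrite modnMmr -expnSr (_ : (2 * alpha + 1).+1 = 2 * (alpha + 1)) //; lia.
  (* The p-adic valuation is even on the left and 2 alpha + 1 on the right. *)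
  have := congr1 (logn p) su; rewrite lognX lognM ?expn_gt0 ?p0 //; last by rewrite /u; lia.
  by rewrite pfactorK // (lognE p u) (negbTE pu) !andbF; lia.
have q8 := sqr_odd_mod8 alpha op.
have [s su] : exists s, s ^ 2 = p ^ (2 * alpha) * (8 * (p * n + j) + 1).
  apply: odd_b13_square ob.
    have : odd ((8 * j + 1) * p ^ (2 * alpha)) by rewrite oddM oddX op; lia.
    rewrite (_ : 2 * alpha + 1 = (2 * alpha).+1) ?expnS; last by lia.
    by move: (p ^ _) => q oq; nia.
  by rewrite -modnMml q8; lia.
(* Dividing the square by p^(2 alpha) leaves a square y^2 congruent to 8 j + 1 mod p, against the
   Legendre symbol -1. *)
have /dvdnP[y sy] : p ^ alpha %| s.
  by rewrite -(@dvdn_pexp2r _ _ 2) // -expnM mulnC su dvdn_mulr.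
have yE : y ^ 2 = 8 * (p * n + j) + 1.
  move: su; rewrite sy expnMn -expnM [alpha * 2]mulnC [RHS]mulnC => /eqP.
  by rewrite eqn_pmul2r ?expn_gt0 ?p0 // => /eqP.
move: leg; rewrite /legendre; case: ifP => // _; case: ifP => // /existsP[].
exists (Ordinal (ltn_pmod y p0)) => /=.
rewrite modnMm mulnn yE; apply/eqP.
rewrite (_ : 8 * (p * n + j) + 1 = (8 * n) * p + (8 * j + 1)) ?modnMDl //; lia.
Qed.
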